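(* Let $p\geq1$, $r\geq1$ and $n\geq1$. Then: (1) if $p=1$, $diam(I\Gamma_{n}^{(p,r)})=n$; (2) if $p\geq2$: (2.1) if $r<p$, then $diam(I\Gamma_{n}^{(p,r)})= 2r\lfloor\frac{n}{p+r}\rfloor+\min\{n \bmod (p+r),\,2r\}$; (2.2) if $p\leq r \leq p+1$, then $diam(I\Gamma_{n}^{(p,r)})=n$; (2.3) if $p+2\leq r\leq 2p+2$, then $diam(I\Gamma_{n}^{(p,r)})=n$; (2.4) if $r\geq2p+3$ and $n< 2p+3$, then $diam(I\Gamma_{n}^{(p,r)})=n$; (2.5) if $r\geq2p+3$ and $n\geq2p+3$, then $n+c\lfloor\frac{n}{r'+p}\rfloor\leq diam(I\Gamma_{n}^{(p,r)})\leq n+c\lceil\frac{n}{r'}\rceil$ for some integers $c\geq1$ and $r'$ with $2p+3\leq r'\leq r$.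
   Context: For positive integers $n,p,r$, $I\Gamma_{n}^{(p,r)}$ is the graph whose vertices are the binary words of length $n$ in which every maximal block of consecutive $1$s has length at most $r$ and any two distinct blocks of $1$s are separated by at least $p$ zeros; two vertices are adjacent iff they differ in exactly one coordinate. $diam$ denotes the diameter (maximum graph distance between two vertices). *)

(* Defs.v *)
From mathcomp Require Import all_boot.

Set Implicit Arguments.
Unset Strict Implicit.
Unset Printing Implicit Defensive.

Definition factor (w : seq bool) (i j : nat) : seq bool :=
  take (j - i) (drop i w).

(* The half-open interval of positions [i, j) is a maximal block of
   consecutive 1s (= true) of w. The default value false of nth makes the
   last condition hold when j is the length of w. *)
Definition ones_block (w : seq bool) (i j : nat) : bool :=
  [&& i < j <= size w,
      all id (factor w i j),
      (i == 0) || ~~ nth false w i.-1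
    & ~~ nth false w j].

Definition pr_word (p r : nat) (w : seq bool) : bool :=
  [forall i : 'I_(size w).+1, forall j : 'I_(size w).+1,
     ones_block w i j ==> (j - i <= r)]
  && [forall i : 'I_(size w).+1, forall j : 'I_(size w).+1,
      forall k : 'I_(size w).+1, forall l : 'I_(size w).+1,
        [&& ones_block w i j, ones_block w k l & i < k]
          ==> (p <= count negb (factor w j k))].

Definition IGamma (n p r : nat) : Type := {w : n.-tuple bool | pr_word p r w}.

Definition IGamma_adj (n p r : nat) : rel (IGamma n p r) :=
  fun u v => #|[set i : 'I_n | tnth (val u) i != tnth (val v) i]| == 1.

Definition walk (T : finType) (e : rel T) (k : nat) (x y : T) : bool :=
  [exists s : k.-tuple T, path e x s && (last x s == y)].

(* The least length of a walk from x to y. A shortest walk has fewer than #|T|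
   edges, so #|T| stands for an infinite distance when y is unreachable. *)
Definition dist (T : finType) (e : rel T) (x y : T) : nat :=
  find (fun k => walk e k x y) (iota 0 #|T|).

Definition diam (T : finType) (e : rel T) : nat :=
  \max_(x : T) \max_(y : T) dist e x y.

Definition ceil_divn (m d : nat) : nat := (m + d.-1) %/ d.

(* Main.v *)
Require Import Defs.
From mathcomp Require Import all_boot zify.
From Stdlib Require Import Classical.

Set Implicit Arguments.
Unset Strict Implicit.
Unset Printing Implicit Defensive.

(** A block of ones only shrinks at its ends when [1 < p], so along a walk from
    [u] to [v] the ones that are never deleted lie, inside each block of [u], in
    a single block of [v], and vice versa. Hence the distance is [|u| + |v|]
    minus twice the largest weight of a matching between overlapping blocks of
    [u] and [v]. When [p <= 1] or [r <= p + 1] it is the Hamming distance. In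
    general, a left-to-right greedy matching shares the common ones out between
    disjoint windows, each inside one block, so that the excess of the distance
    over [n] is at most the sum of the excesses [|q| - 2t] of the windows, where
    [q] is the share of the window and [t] its longest run. An excess is
    positive only with three runs, hence only in windows of length at least
    [2p + 3]. For longer runs [r'] and [c] are the length and the excess of a
    window with the largest ratio excess / length; repeating it gives the lower
    bound. *)

(** * Words *)

Definition ones (f : nat -> bool) (a b : nat) : nat := \sum_(a <= i < b) f i.

Lemma ones_recr f a b : a <= b -> ones f a b.+1 = ones f a b + f b.
Proof. by move=> ab; rewrite /ones big_nat_recr. Qed.

Lemma ones_geq f a b : b <= a -> ones f a b = 0.
Proof. by move=> ba; rewrite /ones big_geq. Qed.

Lemma ones_cat f a b c : a <= b <= c -> ones f a c = ones f a b + ones f b c.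
Proof. by case/andP=> ab bc; rewrite /ones (big_cat_nat ab bc). Qed.

Lemma leq_ones (f g : nat -> bool) a b :
  (forall i, a <= i < b -> f i -> g i) -> ones f a b <= ones g a b.
Proof.
move=> fg; rewrite /ones big_nat_cond [leqRHS]big_nat_cond.
apply: leq_sum => i; rewrite andbT => /fg.
by case: (f i) => // /(_ isT) ->.
Qed.

Lemma eq_ones (f g : nat -> bool) a b :
  (forall i, a <= i < b -> f i = g i) -> ones f a b = ones g a b.
Proof. by move=> fg; apply: eq_big_nat => i /fg ->. Qed.

Lemma ones_true a b : ones xpredT a b = b - a.
Proof. by rewrite /ones sum_nat_const_nat muln1. Qed.

Lemma ones_false a b : ones xpred0 a b = 0.
Proof. by rewrite /ones big1. Qed.

Lemma ones_leq f a b : ones f a b <= b - a.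
Proof. by rewrite -ones_true; apply: leq_ones. Qed.

Lemma ones_all (f : nat -> bool) a b : (forall i, a <= i < b -> f i) -> ones f a b = b - a.
Proof. by move=> fT; rewrite -ones_true; apply: eq_ones. Qed.

Lemma ones_none (f : nat -> bool) a b :
  (forall i, a <= i < b -> ~~ f i) -> ones f a b = 0.
Proof.
by move=> f0; rewrite -(ones_false a b); apply: eq_ones => i /f0 /negbTE.
Qed.

Lemma ones_gt0 (f : nat -> bool) a b : 0 < ones f a b -> exists2 i, a <= i < b & f i.
Proof.
elim: b => [|b IH]; first by rewrite ones_geq.
case: (leqP a b) => ab; last by rewrite ones_geq.
rewrite ones_recr //; case fb: (f b) => H; first by exists b; lia.
by rewrite addn0 in H; case: (IH H) => i ? ?; exists i; lia.
Qed.

Lemma ones_addI (f g : nat -> bool) a b :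
  ones f a b + ones g a b =
  ones (fun i => f i || g i) a b + ones (fun i => f i && g i) a b.
Proof.
by rewrite /ones -!big_split; apply: eq_bigr => i _; case: (f i) (g i) => [] [].
Qed.

Lemma ones_del (f : nat -> bool) a b c : a <= c < b -> f c ->
  ones f a b = (ones (fun i => f i && (i != c)) a b).+1.
Proof.
move=> acb fc.
rewrite !(@ones_cat _ a c b) ?(@ones_cat _ c c.+1 b); try lia.
rewrite !ones_recr // !(ones_geq _ (leqnn c)) fc eqxx.
rewrite (@eq_ones (fun i => f i && (i != c)) f a c); last first.
  by move=> i ?; rewrite (_ : i != c) ?andbT //; lia.
rewrite (@eq_ones (fun i => f i && (i != c)) f c.+1 b) /=; last first.
  by move=> i ?; rewrite (_ : i != c) ?andbT //; lia.
by lia.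
Qed.

(** Two ones with a zero between them lie in different blocks, so at least [p] positions separate
    them; this form names no blocks. *)
Definition gapped p (f : nat -> bool) :=
  forall i j k, i < j < k -> f i -> f k -> ~~ f j -> i + p < k.

Definition runs_le r (f : nat -> bool) :=
  forall i j, (forall k, i <= k < j -> f k) -> j <= i + r.

Definition valid p r f := gapped p f /\ runs_le r f.

Lemma run_right (f : nat -> bool) n i : (forall k, f k -> k < n) -> f i ->
  exists b, [/\ i < b <= n, forall k, i <= k < b -> f k & ~~ f b].
Proof.
move=> fn fi.
have ex : exists k, ~~ f (i + k).
  by exists n; apply/negP => /fn; lia.
case: (ex_minnP ex) => m fm mmin; exists (i + m); split=> //.
- have m0 : m <> 0 by move=> E; move: fm; rewrite E addn0 fi.
  have := mmin (n - i); case Hn: (f (i + (n - i))).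
    by move/fn: Hn; have := fn _ fi; lia.
  by have := fn _ fi => ? /(_ isT); lia.
- move=> k ikm; apply/negPn/negP => fk.
  by have := mmin (k - i); rewrite subnKC; [move/(_ fk)|]; lia.
Qed.

Lemma run_left (f : nat -> bool) i : f i ->
  exists a, [/\ a <= i, forall k, a <= k <= i -> f k & (a == 0) || ~~ f a.-1].
Proof.
elim: i => [|i IH] fi; first by exists 0; split=> // k; rewrite leqn0 => /eqP ->.
case fi': (f i); last first.
  exists i.+1; split; rewrite /= ?fi' // => k ik.
  by have -> : k = i.+1 by lia.
case: (IH fi') => a [ai fa fa']; exists a; split=> //; first lia.
move=> k ak; case: (ltngtP k i.+1) => [? | | ->] //; last lia.
by apply: fa; lia.
Qed.

Lemma nth_factor w i j k : k < j - i -> nth false (factor w i j) k = nth false w (i + k).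
Proof. by move=> kji; rewrite /factor nth_take // nth_drop. Qed.

Lemma size_factor w i j : i <= j <= size w -> size (factor w i j) = j - i.
Proof. by move=> ij; rewrite /factor size_takel // size_drop; lia. Qed.

Lemma ones_blockP w i j :
  reflect [/\ i < j <= size w, forall k, i <= k < j -> nth false w k,
              (i == 0) || ~~ nth false w i.-1 & ~~ nth false w j]
          (ones_block w i j).
Proof.
apply: (iffP and4P) => -[ij H1 H2 H3]; split=> //.
  move=> k ikj; move/(all_nthP false): H1 => /(_ (k - i)).
  by rewrite size_factor ?nth_factor ?subnKC; lia.
apply/(all_nthP false) => k; rewrite size_factor; last lia.
by move=> kij; rewrite nth_factor //=; apply: H1; lia.
Qed.

Lemma count_zeros w i j : i <= j <= size w ->
  count negb (factor w i j) = ones (fun k => ~~ nth false w k) i j.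
Proof.
move=> ij.
have E : factor w i j = [seq nth false w k | k <- iota i (j - i)].
  apply: (@eq_from_nth _ false); rewrite size_factor // ?size_map ?size_iota //.
  by move=> k kij; rewrite nth_factor // (nth_map 0) ?size_iota // nth_iota.
rewrite E count_map /ones /index_iota.
by elim: (iota _ _) => [|a s IH]; rewrite ?big_nil // big_cons /= -IH.
Qed.

Lemma pr_wordP p r w : pr_word p r w <-> valid p r (nth false w).
Proof.
have lt_size k : nth false w k -> k < size w.
  by move=> wk; rewrite ltnNge; apply/negP => /(nth_default false) E; rewrite E in wk.
have block i : nth false w i -> exists a b, [/\ a <= i < b & ones_block w a b].
  move=> wi; have [b [ib fb wb]] := run_right lt_size wi.
  have [a [ai fa wa]] := run_left wi; exists a, b; split; first lia.
  apply/ones_blockP; split=> //; first lia.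
  by move=> k akb; case: (leqP k i) => ?; [apply: fa | apply: fb]; lia.
split.
- case/andP=> /forallP H1 /forallP H2; split.
    move=> i j k ijk wi wk wj.
    have [a [b [aib B1]]] := block _ wi; have [c [d [ckd B2]]] := block _ wk.
    have [B1a B1b B1c B1d] := ones_blockP _ _ _ B1.
    have [B2a B2b B2c B2d] := ones_blockP _ _ _ B2.
    have bj : b <= j.
      by rewrite leqNgt; apply/negP => jb; move: wj; rewrite B1b //; lia.
    have cj : j < c.
      by rewrite ltnNge; apply/negP => jb; move: wj; rewrite B2b //; lia.
    have la : a < (size w).+1 by lia.
    have lb : b < (size w).+1 by lia.
    have lc : c < (size w).+1 by lia.
    have ld : d < (size w).+1 by lia.
    move: (H2 (Ordinal la)) => /forallP/(_ (Ordinal lb))/forallP/(_ (Ordinal lc)).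
    move=> /forallP/(_ (Ordinal ld)) /=; rewrite B1 B2 /=.
    move=> /implyP/(_ _) H; have : p <= count negb (factor w b c) by apply: H; lia.
    rewrite count_zeros; last lia.
    by have := ones_leq (fun k => ~~ nth false w k) b c; lia.
  move=> i j wij; case: (leqP j i) => ij; first lia.
  have wi : nth false w i by apply: wij; lia.
  have [a [b [aib B1]]] := block _ wi.
  have [B1a B1b B1c B1d] := ones_blockP _ _ _ B1.
  have jb : j <= b.
    by rewrite leqNgt; apply/negP => jb; move: B1d; rewrite wij //; lia.
  have la : a < (size w).+1 by lia.
  have lb : b < (size w).+1 by lia.
  by move: (H1 (Ordinal la)) => /forallP/(_ (Ordinal lb)) /=; rewrite B1 /=; lia.
- case=> G Rn; apply/andP; split.
    apply/forallP => i; apply/forallP => j; apply/implyP => /ones_blockP [ij A _ _].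
    by have := Rn _ _ A; lia.
  apply/forallP => -[i /= _]; apply/forallP => -[j /= _].
  apply/forallP => -[k /= _]; apply/forallP => -[l /= _]; apply/implyP.
  case/and3P=> /ones_blockP [ij A _ Aj] /ones_blockP [kl B Bk _].
  move=> ik.
  have wk : nth false w k by apply: B; lia.
  have jk : j < k.
    rewrite ltnNge; apply/negP => kj.
    have [E|kj'] := eqVneq k j; first by rewrite -E wk in Aj.
    by move: Bk; rewrite A ?orbF; lia.
  have w1 : nth false w j.-1 by apply: A; lia.
  (* A one among the [p] positions from [j] on would be too close to [j.-1], the last one of the
     block, across the zero [j]. *)
  have Z m : j <= m < j + p -> ~~ nth false w m.
    move=> jm; apply/negP => wm.
    case: (ltngtP j m) => jm'; [|lia|by rewrite jm' wm in Aj].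
    by have := G j.-1 j m; move=> /(_ _ w1 wm Aj); lia.
  have jpk : j + p <= k.
    by rewrite leqNgt; apply/negP => ?; have := Z k; rewrite wk; lia.
  rewrite count_zeros; last lia.
  rewrite (@ones_cat _ j (j + p) k) ?(ones_all Z); lia.
Qed.

(** * Walks *)

Section Distance.
Variables (T : finType) (e : rel T).

Definition reach k x y := exists s, [/\ size s = k, path e x s & last x s = y].

Lemma walkP k x y : reflect (reach k x y) (walk e k x y).
Proof.
apply: (iffP existsP) => [[s /andP [ps /eqP ls]]|[s [/eqP sk ps ls]]].
  by exists s; rewrite size_tuple.
by exists (Tuple sk); rewrite /= ps ls eqxx.
Qed.

Lemma reach0 x : reach 0 x x.
Proof. by exists [::]. Qed.

Lemma reach_step k x y z : e x y -> reach k y z -> reach k.+1 x z.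
Proof. by move=> exy [s [<- ps ls]]; exists (y :: s); rewrite /= exy. Qed.

Lemma reach_cat k l x y z : reach k x y -> reach l y z -> reach (k + l) x z.
Proof.
move=> [s [<- ps <-]] [t [<- pt <-]]; exists (s ++ t).
by rewrite size_cat cat_path ps last_cat.
Qed.

Lemma reach_sym k x y : symmetric e -> reach k x y -> reach k y x.
Proof.
move=> se [s [<- ps ls]]; exists (rev (belast x s)).
rewrite size_rev size_belast -ls rev_path; split=> //.
  by rewrite (eq_path (e' := e)) // => a b; rewrite /= se.
by case: s {ps ls} => // a s; rewrite /= rev_cons last_rcons.
Qed.

Lemma dist_leq k x y : reach k x y -> dist e x y <= k.
Proof.
move=> /walkP Wk; rewrite /dist leqNgt; apply/negP => kd.
have := before_find 0 kd; rewrite nth_iota ?add0n ?Wk //.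
by apply: leq_trans kd _; rewrite -[leqRHS](size_iota 0) find_size.
Qed.

(** A walk without repeated vertices has length below [#|T|], so the search in [dist] succeeds. *)
Lemma reach_dist k x y : reach k x y -> reach (dist e x y) x y.
Proof.
move=> [s [_ ps ls]]; apply/walkP; move: ls.
have [s' ps' us' _ ls'] := shortenP ps.
have W : has (fun k => walk e k x y) (iota 0 #|T|).
  apply/hasP; exists (size s'); last by apply/walkP; exists s'.
  by rewrite mem_iota /= add0n; have := max_card (mem (x :: s')); rewrite (card_uniqP us').
by have := nth_find 0 W; rewrite nth_iota ?add0n // -[ltnRHS](size_iota 0) -has_find.
Qed.

Lemma dist_leq_diam x y : dist e x y <= diam e.
Proof.
by apply: leq_trans (leq_bigmax (F := fun x => \max_y dist e x y) x); apply: leq_bigmax.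
Qed.

Lemma diam_leq d : (forall x y, dist e x y <= d) -> diam e <= d.
Proof. by move=> H; apply/bigmax_leqP => x _; apply/bigmax_leqP => y _. Qed.

End Distance.

(** * Bounds on the distance between two words *)

Section Words.
Variables n p r : nat.
Notation word := (IGamma n p r).
Notation adj := (@IGamma_adj n p r).

Definition letter (u : word) : nat -> bool := nth false (val u).

Lemma letter_valid u : valid p r (letter u).
Proof. by case: u => u pu; apply/pr_wordP. Qed.

Lemma letter_lt u i : letter u i -> i < n.
Proof.
move=> ui; rewrite ltnNge; apply/negP => ni.
by move: ui; rewrite /letter nth_default // size_tuple.
Qed.

Lemma letter_inj u v : (forall i, i < n -> letter u i = letter v i) -> u = v.
Proof.
move=> uv; apply/val_inj/val_inj; apply: (@eq_from_nth _ false).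
  by rewrite !size_tuple.
by rewrite size_tuple => i; exact: uv.
Qed.

(** Cutting off at [n] creates no zero between two remaining ones. *)
Lemma word_of f : valid p r f -> exists u : word, forall i, i < n -> letter u i = f i.
Proof.
move=> [Gf Rf].
have E i : nth false (mkseq f n) i = (i < n) && f i.
  case: (ltnP i n) => ni; first by rewrite nth_mkseq.
  by rewrite nth_default // size_mkseq.
have P : pr_word p r (mkseq f n).
  apply/pr_wordP; split.
    move=> i j k ijk; rewrite !E => /andP [_ fi] /andP [kn fk] fj.
    by apply: (Gf i j k) => //; move: fj; rewrite (_ : j < n) //; lia.
  by move=> i j fij; apply: Rf => k /fij; rewrite E => /andP [].
exists (Sub (Tuple (introT eqP (size_mkseq f n))) P) => i ni.
by rewrite /letter SubK E ni.
Qed.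

Lemma adjP u v :
  reflect (exists2 c, c < n & forall i, (letter u i != letter v i) = (i == c)) (adj u v).
Proof.
have E (i : 'I_n) w : tnth (val w) i = letter w i by rewrite (tnth_nth false).
apply: (iffP cards1P) => [[c /setP H]|[c cn H]].
  exists c => // i; case: (ltnP i n) => ni.
    by have := H (Ordinal ni); rewrite !inE !E.
  rewrite /letter !nth_default ?size_tuple // eqxx.
  by apply/esym/negbTE; rewrite neq_ltn orbC (leq_trans _ ni).
by exists (Ordinal cn); apply/setP => i; rewrite !inE !E H.
Qed.

Lemma adj_sym : symmetric adj.
Proof.
move=> u v; rewrite /IGamma_adj; congr (_ == 1).
by apply: eq_card => i; rewrite !inE eq_sym.
Qed.

(** A one of either end that is not persistent has to be deleted or inserted. *)
Lemma walk_persistent u s :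
  path adj u s ->
  exists2 P : nat -> bool,
    (forall i, P i <-> forall w, w \in u :: s -> letter w i) &
    ones (letter u) 0 n + ones (letter (last u s)) 0 n <= size s + 2 * ones P 0 n.
Proof.
elim: s u => [|v s IH] u /=.
  move=> _; exists (letter u); last by lia.
  by move=> i; split=> [ui w|]; [rewrite inE => /eqP -> | apply; rewrite mem_head].
case/andP=> /adjP [c cn uv] /IH [P PE PL].
exists (fun i => letter u i && P i).
  move=> i; split=> [/andP [ui /PE Pi] w|H].
    by rewrite inE => /orP [/eqP -> // | /Pi].
  by rewrite H ?mem_head //=; apply/PE => w ws; apply: H; rewrite inE ws orbT.
have Pv i : P i -> letter v i by move/PE => H; apply: H; rewrite mem_head.
have uvE i : i != c -> letter u i = letter v i.
  by move=> ic; apply/eqP; move: (uv i); rewrite (negbTE ic) => /negbFE.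
have uvc : letter u c = ~~ letter v c.
  by move: (uv c); rewrite eqxx; case: (letter u c) (letter v c) => [] [].
(* If the first step deletes [c], the persistent set is unchanged and [u] has one more one than [v].
   If it inserts [c], the set may lose [c], which costs two, while [u] has one less one and the walk
   one more step. *)
case vc: (letter v c); last first.
  have PP : ones (fun i => letter u i && P i) 0 n = ones P 0 n.
    apply: eq_ones => i _; case Pi: (P i); rewrite ?andbF // andbT.
    by rewrite uvE ?Pv //; apply/eqP => E; rewrite -E Pv in vc.
  rewrite PP (@ones_del (letter u) 0 n c) ?cn ?uvc ?vc //.
  rewrite (@eq_ones _ (letter v)); first lia.
  by move=> i _; case: eqVneq => [->|ic]; rewrite ?vc ?andbF // uvE ?andbT.
have Eu : ones (letter v) 0 n = (ones (letter u) 0 n).+1.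
  rewrite (@ones_del (letter v) 0 n c) ?cn ?vc //; congr S; apply: eq_ones => i _.
  by case: eqVneq => [->|ic]; rewrite ?uvc ?vc ?andbF // uvE ?andbT.
have EP : ones P 0 n <= (ones (fun i => letter u i && P i) 0 n).+1.
  case Pc: (P c).
    rewrite (@ones_del P 0 n c) ?cn // ltnS; apply: leq_ones => i _ /andP [Pi ic].
    by rewrite uvE // Pv // Pi.
  apply: leqW; apply: leq_ones => i _ Pi; rewrite uvE ?Pv //.
  by apply/eqP => E; rewrite -E Pi in Pc.
by lia.
Qed.

(** For [1 < p] a block cannot be broken in its interior, so a block of [u]
    keeps persistent ones in at most one block of [v]. *)
Lemma walk_lower k u v : 1 < p -> reach adj k u v ->
  exists P : nat -> bool,
  [/\ forall i, P i -> letter u i && letter v i,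
      forall i j, P i -> P j -> (forall m, i <= m <= j -> letter u m) ->
        forall m, i <= m <= j -> letter v m &
      ones (letter u) 0 n + ones (letter v) 0 n <= k + 2 * ones P 0 n].
Proof.
move=> p1 [s [<- ps ls]]; have [P PE PL] := walk_persistent ps.
exists P; split; last by rewrite -ls.
  by move=> i /PE Pi; rewrite -ls !Pi ?mem_last ?mem_head.
move=> i j Pi Pj; rewrite -ls {ls PL}.
have {PE Pi Pj} : forall w, w \in u :: s -> letter w i && letter w j.
  by move=> w ws; move/PE: Pi => ->//; move/PE: Pj => ->.
elim: s u ps => [|v' s IH] u //= /andP [/adjP [c cn uv] ps] Pij uij.
apply: IH => // [w ws|m mij]; first by apply: Pij; rewrite inE ws orbT.
have /andP [vi vj] : letter v' i && letter v' j by apply: Pij; rewrite inE mem_head orbT.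
have uvE l : l != c -> letter u l = letter v' l.
  by move=> lc; apply/eqP; move: (uv l); rewrite (negbTE lc) => /negbFE.
case: (eqVneq m c) => [E|mc]; last by rewrite -uvE ?uij.
(* Deleting [m] strictly between [i] and [j] would leave ones on both sides of a single zero,
   against [1 < p]. *)
apply/negPn/negP => vm; have [G _] := letter_valid v'.
have im : i != m by apply: contraNneq vm => <-.
have jm : j != m by apply: contraNneq vm => <-.
have a1 : letter v' m.-1 by rewrite -uvE ?uij; lia.
have a2 : letter v' m.+1 by rewrite -uvE ?uij; lia.
by have := G m.-1 m m.+1; move=> /(_ _ a1 a2 vm); lia.
Qed.

(** Inside each block of [u], the set [z] is an interval, possibly empty: what remains when blocks
    shrink only at their ends. *)
Definition convex_in (u z : nat -> bool) :=
  forall i k, z i -> z k -> (forall m, i <= m <= k -> u m) ->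
  forall j, i <= j <= k -> z j.

(** If [u] has a zero between two ones of [z], the gap is inherited from [u]; if it has none,
    convexity leaves no gap in [z]. *)
Lemma valid_sub (u z : nat -> bool) :
  (forall i, z i -> u i) -> convex_in u z -> valid p r u -> valid p r z.
Proof.
move=> zu cz [G Rn]; split; last by move=> i j zij; apply: Rn => k /zij /zu.
move=> i j k ijk zi zk zj; case uj: (u j); last first.
  by apply: (G i j k) => //; [exact: zu | exact: zu | rewrite uj].
rewrite ltnNge; apply/negP => kip; move: zj; rewrite (cz i k) //; last lia.
move=> m imk; apply/negPn/negP => um.
have im : i != m by apply: contraNneq um => <-; apply: zu.
have km : k != m by apply: contraNneq um => <-; apply: zu.
have : i + p < k by apply: (G i m k) => //; [lia | exact: zu | exact: zu].
by lia.
Qed.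

(** For [p <= 1] the gap condition is void and any surplus one may go. Otherwise the block of a
    surplus one has an end outside [z], since with both ends in [z] convexity would put the surplus
    one there too. *)
Lemma removable u (z : nat -> bool) : (forall i, z i -> letter u i) ->
  p <= 1 \/ convex_in (letter u) z -> ones z 0 n < ones (letter u) 0 n ->
  exists c, [/\ letter u c, ~~ z c & valid p r (fun i => letter u i && (i != c))].
Proof.
move=> zu cz lt_zu; have [G Rn] := letter_valid u.
have [i ui zi] : exists2 i, letter u i & ~~ z i.
  have /ones_gt0 [i _ /andP [ui zi]] : 0 < ones (fun i => letter u i && ~~ z i) 0 n.
    have := ones_addI z (fun i => letter u i && ~~ z i) 0 n.
    rewrite (@eq_ones (fun i => z i || _) (letter u)); last first.
      by move=> i _; case zi: (z i); [rewrite zu | case: (letter u i)].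
    by rewrite (@ones_none (fun i => z i && _)) => [|i _]; [lia | case: (z i); rewrite ?andbF].
  by exists i.
have Rn' c : runs_le r (fun i => letter u i && (i != c)).
  by move=> a b ab; apply: Rn => m /ab /andP [].
have [p1|cz'] := cz.
  exists i; split=> //; split=> // a b c abc _ _ _; lia.
have [b [ib ub ub']] := run_right (@letter_lt u) ui.
have [a [ai ua ua']] := run_left ui.
have uab m : a <= m <= b.-1 -> letter u m.
  by move=> mab; case: (leqP m i) => ?; [apply: ua | apply: ub]; lia.
(* A zero of [u] beside the deleted end already separated the two ones. *)
have G' c : (c = a \/ c = b.-1) -> gapped p (fun i => letter u i && (i != c)).
  move=> cab x y w xyw /andP [ux xc] /andP [uw wc]; rewrite negb_and negbK.
  case/orP=> [uy|/eqP yc]; first exact: (G x y w).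
  case: cab => ?; subst c.
    have x1 : letter u a.-1 = false by move: ua'; case: eqP => [|_ /negbTE] //; lia.
    apply: (G x a.-1 w) => //; rewrite ?x1 //.
    by case: (eqVneq x a.-1) => E; [rewrite -E ux in x1|]; lia.
  by apply: (G x b w) => //; case: (eqVneq w b) => E; [rewrite -E uw in ub'|]; lia.
case za: (z a); last by exists a; split; rewrite ?za ?uab //; [lia | split; auto].
case zb: (z b.-1); last by exists b.-1; split; rewrite ?zb ?uab //; [lia | split; auto].
by case/negP: zi; apply: (cz' a b.-1) => //; lia.
Qed.

Lemma descend u (z : nat -> bool) w : (forall i, z i -> letter u i) ->
  p <= 1 \/ convex_in (letter u) z -> (forall i, i < n -> letter w i = z i) ->
  reach adj (ones (letter u) 0 n - ones z 0 n) u w.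
Proof.
move=> zu cz wz; have [m Em] : exists m, m = ones (letter u) 0 n - ones z 0 n by eexists.
elim: m u zu cz Em => [|m IH] u zu cz Em; rewrite -Em.
  suff -> : w = u by apply: reach0.
  apply: letter_inj => i ni; rewrite wz //; case zi: (z i); first by rewrite zu.
  apply/esym/negbTE/negP => ui.
  have : ones z 0 n <= ones (fun k => letter u k && (k != i)) 0 n.
    apply: leq_ones => k _ zk; rewrite zu //.
    by apply/eqP => E; rewrite -E zk in zi.
  by have := @ones_del (letter u) 0 n i ni ui; lia.
have [c [uc zc V]] := removable zu cz ltac:(lia).
have cn := letter_lt uc; have [u' u'E] := word_of V.
have {}u'E i : letter u' i = letter u i && (i != c).
  case: (ltnP i n) => ni; first exact: u'E.
  by rewrite /letter !nth_default ?size_tuple.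
have D := @ones_del (letter u) 0 n c cn uc.
have Eo : ones (letter u') 0 n = ones (fun i => letter u i && (i != c)) 0 n.
  by apply: eq_ones => i _.
have R : reach adj (ones (letter u') 0 n - ones z 0 n) u' w.
  have Em' : m = ones (letter u') 0 n - ones z 0 n by lia.
  apply: IH => //.
  - by move=> i zi; rewrite u'E zu //; apply: contraNneq zc => <-.
  - case: cz => [|cz]; [by left | right => i k zi zk uik; apply: cz => // l /uik].
    by rewrite u'E => /andP [].
have -> : m = ones (letter u') 0 n - ones z 0 n by lia.
apply: reach_step R; apply/adjP; exists c => // i; rewrite u'E.
by case: (eqVneq i c) => [->|_]; rewrite ?uc ?andbF // andbT eqxx.
Qed.

(** The walk deletes from [u] down to [z], then inserts up to [v]. *)
Lemma dist_upper u v (z : nat -> bool) :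
  (forall i, z i -> letter u i && letter v i) ->
  p <= 1 \/ convex_in (letter u) z /\ convex_in (letter v) z ->
  reach adj (ones (letter u) 0 n + ones (letter v) 0 n - 2 * ones z 0 n) u v.
Proof.
move=> zuv cz.
have zu i : z i -> letter u i by case/zuv/andP.
have zv i : z i -> letter v i by case/zuv/andP.
have Vz : valid p r z.
  case: cz => [p1|[cz _]]; last exact: valid_sub (letter_valid u).
  split; first by move=> i j k; lia.
  by move=> i j zij; apply: (letter_valid u).2 => k /zij /zu.
have [w wz] := word_of Vz.
have cu : p <= 1 \/ convex_in (letter u) z by case: cz => [|[]]; auto.
have cv : p <= 1 \/ convex_in (letter v) z by case: cz => [|[]]; auto.
have Ru := descend zu cu wz; have Rv := descend zv cv wz.
have := reach_cat Ru (reach_sym adj_sym Rv).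
have Lu : ones z 0 n <= ones (letter u) 0 n by apply: leq_ones => i _; apply: zu.
have Lv : ones z 0 n <= ones (letter v) 0 n by apply: leq_ones => i _; apply: zv.
by congr reach; lia.
Qed.

(** The walk passes through the zero word. *)
Lemma adj_connected u v : exists k, reach adj k u v.
Proof.
eexists; apply: (@dist_upper u v xpred0) => //.
by right; split=> i k.
Qed.

Lemma dist_reach u v : reach adj (dist adj u v) u v.
Proof. by have [k H] := adj_connected u v; apply: reach_dist H. Qed.

(** Persistent ones are common to both ends. *)
Lemma hamming_leq_dist u v :
  ones (letter u) 0 n + ones (letter v) 0 n <=
  dist adj u v + 2 * ones (fun i => letter u i && letter v i) 0 n.
Proof.
have [s [<- ps ls]] := dist_reach u v; have [P PE] := walk_persistent ps.
rewrite ls; have : ones P 0 n <= ones (fun i => letter u i && letter v i) 0 n.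
  by apply: leq_ones => i _ /PE Pi; rewrite -ls !Pi ?mem_head ?mem_last.
by move=> A B; apply: leq_trans B _; rewrite leq_add2l leq_mul2l.
Qed.

End Words.

(** * Matching the blocks of two words *)

(** Such a [z] matches overlapping blocks of [u] and [v]: convexity on both sides lets each block
    keep ones in at most one block of the other word. The bound [N] serves the construction from
    left to right. *)
Record kept (u v : nat -> bool) N (z : nat -> bool) : Prop := Kept {
  kept_sub : forall i, z i -> [/\ i < N, u i & v i];
  kept_convl : convex_in u z;
  kept_convr : convex_in v z }.

Lemma kept_sym (u v : nat -> bool) N (z : nat -> bool) : kept u v N z -> kept v u N z.
Proof. by case=> zN cu cv; split=> // i /zN []. Qed.

Lemma kept_widen (u v : nat -> bool) N N' (z : nat -> bool) :
  N <= N' -> kept u v N z -> kept u v N' z.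
Proof. by move=> NN' [zN cu cv]; split=> // i /zN [? -> ->]; split=> //; lia. Qed.

(** This makes the block of [u] that reaches [N] free of kept ones, hence still available for a
    match. *)
Definition closed_before (u : nat -> bool) N z :=
  forall i, z i -> exists2 m, i < m < N & ~~ u m.

(** The added segment starts a block of [v] and lies in a block of [u] without kept ones, so neither
    block is matched twice. *)
Lemma kept_add (u v : nat -> bool) M N (z : nat -> bool) : M <= N -> kept u v M z ->
  closed_before u M z -> (M == 0) || ~~ v M.-1 ->
  (forall i, M <= i < N -> u i && v i) ->
  kept u v N (fun i => z i || (M <= i < N)).
Proof.
move=> MN [zM cu cv] zfree vM uv; split.
- move=> i /orP [/zM [? -> ->]|/[dup] iMN /uv /andP [-> ->]]; split=> //; lia.
- move=> i k /orP [zi|iMN] /orP [zk|kMN] uik j ijk.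
  + by rewrite (cu i k).
  + have [m imM] := zfree _ zi; rewrite uik //; lia.
  + have [? _ _] := zM _ zk; lia.
  + by apply/orP; right; lia.
- move=> i k /orP [zi|iMN] /orP [zk|kMN] vik j ijk.
  + by rewrite (cv i k).
  + have [iM _ _] := zM _ zi; move: vM; rewrite vik ?orbF; lia.
  + have [? _ _] := zM _ zk; lia.
  + by apply/orP; right; lia.
Qed.

(** A block of one word that faces the word [q] of the other costs
    [|q| - 2t] more than its length, [t] being the longest run of [q]. *)
Definition bounded_excess p r R C :=
  forall (q : nat -> bool) t h h',
  h <= h' <= h + r -> (forall i, q i -> h <= i < h') -> gapped p q -> runs_le t q ->
  R * ones q h h' <= R * (2 * t) + C * (h' - h).

Section Matching.
Variables p r R C : nat.

Hypothesis excess_bound : bounded_excess p r R C.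

(** [z1] is the best set of kept ones found, [z0] leaves the current block of
    [u], which covers the window from [h] to [N], untouched; [q] is the share
    of [u] in the common ones of that window. *)
Inductive window (u v : nat -> bool) N : Prop := Window z0 z1 (q : nat -> bool) t h of
  kept u v N z0 & kept u v N z1 & closed_before u N z0 &
  ones z1 0 N = ones z0 0 N + t &
  h <= N & (forall i, h <= i < N -> u i) &
  (forall i, q i -> h <= i < N /\ v i) & gapped p q & runs_le t q &
  R * ones (fun i => u i && v i) 0 N
    <= R * (2 * ones z0 0 N) + R * ones q h N + C * h.

Lemma window_new (u v : nat -> bool) N (z : nat -> bool) : kept u v N z -> closed_before u N z ->
  R * ones (fun i => u i && v i) 0 N <= R * (2 * ones z 0 N) + C * N ->
  window u v N.
Proof.
move=> kz cz Hz; apply: (@Window u v N z z xpred0 0 N) => //; rewrite ?ones_false //.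
- by rewrite addn0.
- by move=> i; lia.
- move=> i j ij; rewrite addn0 leqNgt; apply/negP => lt_ij.
  by have := ij i; rewrite leqnn lt_ij => /(_ isT).
- by rewrite muln0 addn0.
Qed.

Lemma window_grow (u v : nat -> bool) N : u N -> ~~ v N -> window u v N -> window u v N.+1.
Proof.
move=> uN vN [z0 z1 q t h k0 k1 c0 z01 hN uh qh qg qr H].
have zN z : kept u v N z -> ones z 0 N.+1 = ones z 0 N.
  move=> kz; rewrite ones_recr //; case zN: (z N); last by rewrite addn0.
  by have [] := kept_sub kz zN; rewrite ltnn.
have qN : ones q h N.+1 = ones q h N.
  rewrite ones_recr //; case qN: (q N); last by rewrite addn0.
  by have [] := qh _ qN; lia.
apply: (@Window u v N.+1 z0 z1 q t h); rewrite ?(zN z0) ?(zN z1) ?qN //.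
- exact: kept_widen k0.
- exact: kept_widen k1.
- by move=> i /c0 [m ? ?]; exists m => //; lia.
- lia.
- by move=> i hi; case: (ltngtP i N) => [?||->] //; [apply: uh|]; lia.
- by move=> i /qh [? ->]; split=> //; lia.
- by rewrite ones_recr // (negbTE vN) andbF addn0.
Qed.

(** The set [z1] keeps [t] ones in the current window, and [excess_bound] charges the rest of its
    share [q] to its length. *)
Lemma window_close (u v : nat -> bool) N : valid p r u -> window u v N ->
  exists2 z, kept u v N z &
  R * ones (fun i => u i && v i) 0 N <= R * (2 * ones z 0 N) + C * N.
Proof.
move=> [_ ru] [z0 z1 q t h k0 k1 c0 z01 hN uh qh qg qr H]; exists z1 => //.
have hr := ru _ _ uh.
have := @excess_bound q t h N _ _ qg qr.
have -> : h <= N <= h + r by lia.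
move=> /(_ isT) HB; have {}HB : R * ones q h N <= R * (2 * t) + C * (N - h).
  by apply: HB => i /qh [].
have E : C * N = C * h + C * (N - h) by rewrite -mulnDr subnKC.
rewrite z01 !mulnDr; lia.
Qed.

(** The common ones from [M] on are not yet shared out between the block of [u]
    and the block of [v] that starts at [M]. *)
Definition stretch (u v : nat -> bool) N := exists M,
  [/\ window u v M, M <= N, (M == 0) || ~~ v M.-1 &
      forall i, M <= i < N -> u i && v i].

Lemma stretch_window (u v : nat -> bool) N : window u v N -> (N == 0) || ~~ v N.-1 -> stretch u v N.
Proof. by move=> W vN; exists N; split=> // i; lia. Qed.

Lemma stretch_ones (u v : nat -> bool) M N : M <= N ->
  (forall i, M <= i < N -> u i && v i) -> ones (fun i => u i && v i) 0 N =
  ones (fun i => u i && v i) 0 M + (N - M).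
Proof. by move=> MN uv; rewrite (@ones_cat _ 0 M N) ?(ones_all uv) //; lia. Qed.

Lemma kept_ones u v M N z : M <= N -> kept u v M z -> ones z 0 N = ones z 0 M.
Proof.
move=> MN kz; rewrite (@ones_cat _ 0 M N) ?(@ones_none _ M N) ?addn0 //.
by move=> i iM; apply/negP => /(kept_sub kz) []; lia.
Qed.

Lemma ones_add (q : nat -> bool) h M N : h <= M <= N ->
  ones (fun i => q i || (M <= i < N)) h N = ones q h M + (N - M).
Proof.
move=> hMN; rewrite (@ones_cat _ h M N) //; congr addn.
  by apply: eq_ones => i iM; rewrite [M <= i < N](_ : _ = false) ?orbF; lia.
by apply: ones_all => i ->; rewrite orbT.
Qed.

(** The zero of [v] at [M.-1] separates [q] from the new segment, so the gap between them comes from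
    [v]. *)
Lemma gapped_add (v q : nat -> bool) M N h : (M == 0) || ~~ v M.-1 ->
  gapped p v -> (forall i, M <= i < N -> v i) ->
  (forall i, q i -> h <= i < M /\ v i) -> gapped p q ->
  gapped p (fun i => q i || (M <= i < N)).
Proof.
move=> vM gv vMN qh qg.
move=> i j k ijk /orP [qi|iM] /orP [qk|kM]; rewrite negb_or => /andP [qj jM].
- exact: (qg i j k).
- have [hi vi] := qh _ qi; have vk := vMN _ kM.
  have vM' : ~~ v M.-1 by move: vM; case: eqP => //; lia.
  have iM : i != M.-1 by apply: contraNneq vM' => <-.
  by apply: (gv i M.-1) => //; lia.
- by have [] := qh _ qk; lia.
- lia.
Qed.

Lemma runs_le_add (v q : nat -> bool) M N h t t' : (M == 0) || ~~ v M.-1 ->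
  (forall i, q i -> h <= i < M /\ v i) -> runs_le t q -> t <= t' -> N - M <= t' ->
  runs_le t' (fun i => q i || (M <= i < N)).
Proof.
move=> vM qh qr tt' Nt i j qij; case: (leqP j i) => ij; first lia.
case: (leqP M i) => Mi.
  have : i <= j.-1 < j by lia.
  by move/qij => /orP [/qh [] |]; lia.
have jM : j <= M.
  rewrite leqNgt; apply/negP => Mj.
  have : i <= M.-1 < j by lia.
  move/qij => /orP [/qh [_ v1]|]; last lia.
  by move: vM; rewrite v1 orbF; lia.
suff: j <= i + t by lia.
by apply: qr => k kij; have /orP [//|] := qij _ kij; lia.
Qed.

(** The block of [u] is matched either as in [z1] or with the new stretch added to [z0], whichever
    keeps more. *)
Lemma stretch_best (u v : nat -> bool) M N (z0 z1 : nat -> bool) t :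
  M <= N -> (M == 0) || ~~ v M.-1 ->
  (forall i, M <= i < N -> u i && v i) ->
  kept u v M z0 -> kept u v M z1 -> closed_before u M z0 ->
  ones z1 0 M = ones z0 0 M + t ->
  exists2 z, kept u v N z & ones z 0 N = ones z0 0 M + maxn t (N - M).
Proof.
move=> MN vM uv k0 k1 c0 z01; case: (leqP (N - M) t) => tN.
  exists z1; first exact: kept_widen k1.
  by rewrite (kept_ones MN k1); lia.
exists (fun i => z0 i || (M <= i < N)); first exact: kept_add.
by rewrite ones_add; lia.
Qed.

Lemma stretch_same (u v : nat -> bool) N : valid p r u -> valid p r v ->
  stretch u v N -> window u v N.
Proof.
move=> _ [gv _] [M [[z0 z1 q t h k0 k1 c0 z01 hM uh qh qg qr H] MN vM uv]].
have [z kz Lz] := stretch_best MN vM uv k0 k1 c0 z01.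
apply: (@Window u v N z0 z (fun i => q i || (M <= i < N)) (maxn t (N - M)) h) => //.
- exact: kept_widen k0.
- by move=> i /c0 [m ? ?]; exists m => //; lia.
- by rewrite (kept_ones MN k0).
- lia.
- by move=> i hi; case: (leqP M i) => ?; [by have /uv/andP [] : M <= i < N by lia | apply: uh; lia].
- move=> i /orP [/qh [? ->]|iM]; first by split=> //; lia.
  by have /andP [_ ->] := uv _ iM; split=> //; lia.
- by apply: (gapped_add vM gv _ qh qg) => i /uv /andP [].
- by apply: (runs_le_add vM qh qr); lia.
- by rewrite (stretch_ones MN uv) (kept_ones MN k0) ones_add; lia.
Qed.

(** When the block of [u] ends while that of [v] goes on, the first [t] common
    ones are charged to [u], the rest opens the window of [v]. *)
Lemma stretch_switch (u v : nat -> bool) N : valid p r u -> valid p r v ->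
  stretch u v N -> window v u N.
Proof.
move=> [_ ru] [gv _] [M [[z0 z1 q t h k0 k1 c0 z01 hM uh qh qg qr H] MN vM uv]].
have [z kz Lz] := stretch_best MN vM uv k0 k1 c0 z01.
(* The closing window takes at most [t] of the pending ones, so its longest run stays at most
   [t]. *)
pose h' := minn N (M + t).
have Mh : M <= h' <= N by lia.
have uh' i : h <= i < h' -> u i.
  by move=> hi; case: (leqP M i) => ?; [by have /uv/andP [] : M <= i < N by lia | apply: uh; lia].
have hr := ru _ _ uh'.
have HB : R * ones (fun i => q i || (M <= i < h')) h h' <= R * (2 * t) + C * (h' - h).
  apply: excess_bound; first lia.
  - by move=> i /orP [/qh [] |]; lia.
  - apply: (gapped_add vM gv _ qh qg) => i iM.
    by have /uv/andP [] : M <= i < N by lia.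
  - by apply: (runs_le_add vM qh qr); lia.
rewrite ones_add in HB; last lia.
have quse : ones (fun i => h' <= i < N) h' N = N - h' by apply: ones_all.
(* The roles swap: [z1] leaves the block of [v] free, and matching that block with the pending
   stretch instead gains [maxn t (N - M) - t = N - h']. *)
apply: (@Window v u N z1 z (fun i => h' <= i < N) (N - h') h') => //.
- exact/kept_sym/(kept_widen MN).
- exact/kept_sym.
- move=> i /(kept_sub k1) [iM ui vi].
  have vM' : ~~ v M.-1 by move: vM; case: eqP => //; lia.
  have iM' : i != M.-1 by apply: contraNneq vM' => <-.
  by exists M.-1 => //; lia.
- rewrite (kept_ones MN k1) Lz; lia.
- lia.
- by move=> i hi; have /uv/andP [] : M <= i < N by lia.
- by move=> i hi; split=> //; have /uv/andP [] : M <= i < N by lia.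
- by move=> i j k; lia.
- by move=> i j ij; case: (leqP j i) => ?; [lia|have := ij i; have := ij j.-1; lia].
- rewrite (@eq_ones _ (fun i => u i && v i)) => [|i _]; last by rewrite andbC.
  rewrite (stretch_ones MN uv) (kept_ones MN k1) quse.
  have E : C * h' = C * h + C * (h' - h) by rewrite -mulnDr subnKC //; lia.
  have -> : N - M = (h' - M) + (N - h') by lia.
  by rewrite z01 !mulnDr in HB *; lia.
Qed.

(** Two ones extend the stretch; a one in [u] alone lengthens its window; a one in [v] alone hands
    the window over to [v]; two zeros close it. *)
Lemma stretch_next (u v : nat -> bool) N : valid p r u -> valid p r v ->
  stretch u v N -> stretch u v N.+1 \/ stretch v u N.+1.
Proof.
move=> Vu Vv S; case uN: (u N); case vN: (v N).
- left; case: S => M [W MN vM uv]; exists M; split=> //; first lia.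
  by move=> i iMN; case: (ltngtP i N) => [?||->]; rewrite ?uN ?vN //; [apply: uv|]; lia.
- left; apply: stretch_window; last by rewrite /= vN.
  by apply: window_grow; rewrite ?vN //; apply: stretch_same.
- right; apply: stretch_window; last by rewrite /= uN.
  by apply: window_grow; rewrite ?uN //; apply: stretch_switch.
- have [z kz Hz] := window_close Vu (stretch_same Vu Vv S).
  have Nu : ones (fun i => u i && v i) 0 N.+1 = ones (fun i => u i && v i) 0 N.
    by rewrite ones_recr // uN addn0.
  have Nz : ones z 0 N.+1 = ones z 0 N.
    rewrite ones_recr //; case zN: (z N); last by rewrite addn0.
    by have [] := kept_sub kz zN; rewrite ltnn.
  left; apply: stretch_window; last by rewrite /= vN.
  apply: (@window_new _ _ _ z); first exact: kept_widen kz.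
    by move=> i /(kept_sub kz) [iN _ _]; exists N; rewrite ?uN // iN leqnn.
  by rewrite Nu Nz mulnS; lia.
Qed.

Lemma kept_matching (u v : nat -> bool) N : valid p r u -> valid p r v ->
  exists2 z, kept u v N z &
  R * ones (fun i => u i && v i) 0 N <= R * (2 * ones z 0 N) + C * N.
Proof.
move=> Vu Vv; have close x y : valid p r x -> valid p r y -> stretch x y N ->
    exists2 z, kept x y N z &
    R * ones (fun i => x i && y i) 0 N <= R * (2 * ones z 0 N) + C * N.
  by move=> Vx Vy S; apply: window_close (stretch_same _ _ S).
(* Either word may own the last window; the claim is symmetric in them. *)
have [/close|/close] : stretch u v N \/ stretch v u N; [|exact|].
  elim: N {close} => [|N [IH|IH]]; last 2 first.
  - exact: stretch_next.
  - by apply/or_comm; apply: stretch_next.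
  left; apply: stretch_window => //; apply: (@window_new _ _ _ xpred0) => //.
  by rewrite ones_geq // muln0.
case=> // z kz Hz; exists z; first exact: kept_sym.
by rewrite (@eq_ones _ (fun i => v i && u i)) // => i _; rewrite andbC.
Qed.

End Matching.

(** * Runs and gaps inside a window *)

Lemma peel_run p t (q : nat -> bool) h h' : gapped p q -> runs_le t q ->
  (forall i, q i -> i < h') -> t < ones q h h' ->
  exists s h1, [/\ s <= t, ones q h h' = s + ones q h1 h' & h + s + p <= h1 <= h'].
Proof.
move=> qg qr qh' tq.
have ex : exists i, (h <= i) && q i.
  have /ones_gt0 [i hi qi] : 0 < ones q h h' by lia.
  by exists i; rewrite qi; lia.
case: (ex_minnP ex) => i /andP [hi qi] imin.
have [b [ib qib qb]] := run_right qh' qi.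
have bi := qr _ _ qib.
have hz : ones q h i = 0.
  apply: ones_none => k hk; apply/negP => qk.
  by have := imin k; rewrite qk; lia.
have E : ones q h h' = b - i + ones q b h'.
  by rewrite (@ones_cat _ h i h') ?(@ones_cat _ i b h') ?hz ?(ones_all qib) //; lia.
have gap k : b <= k -> q k -> b + p <= k.
  move=> bk qk; have qb1 : q b.-1 by apply: qib; lia.
  have kb : k != b by apply: contraNneq qb => <-.
  have : b.-1 + p < k by apply: (qg b.-1 b) => //; lia.
  lia.
have /ones_gt0 [k bk qk] : 0 < ones q b h' by lia.
have bpk : b + p <= k by apply: gap => //; lia.
(* Since ones remain beyond the first run, [p] zeros follow it. *)
exists (b - i), (b + p); split; [lia| |lia].
rewrite E (@ones_cat _ b (b + p) h') ?(@ones_none _ b (b + p)) //; last lia.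
by move=> l bl; apply/negP => ql; have := gap l; rewrite ql; lia.
Qed.

(** Two runs hold at most [2 * t] ones, so a third exists, and two gaps of [p] zeros lie between the
    three. *)
Lemma three_runs p t (q : nat -> bool) h h' : gapped p q -> runs_le t q ->
  (forall i, q i -> i < h') -> 2 * t < ones q h h' ->
  ones q h h' + 2 * p <= h' - h.
Proof.
move=> qg qr qh' tq.
have [|s [h1 [st E1 hh1]]] := @peel_run p t q h h' qg qr qh'; first lia.
have [|s' [h2 [st' E2 hh2]]] := @peel_run p t q h1 h' qg qr qh'; first lia.
by have := ones_leq q h2 h'; lia.
Qed.

Lemma runs_le_gt0 t (q : nat -> bool) i : runs_le t q -> q i -> 0 < t.
Proof.
move=> qr qi; have : i.+1 <= i + t; last lia.
by apply: qr => k ik; have -> : k = i by lia.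
Qed.

Lemma ones_shift (f : nat -> bool) a x y :
  ones f (a + x) (a + y) = ones (fun i => f (a + i)) x y.
Proof.
elim: y => [|y IH]; first by rewrite !ones_geq; lia.
case: (leqP x y) => xy; last by rewrite !ones_geq; lia.
by rewrite addnS !ones_recr ?IH; lia.
Qed.

Lemma ones_ltn c m : ones (fun i => i < c) 0 m = minn m c.
Proof.
elim: m => [|m IH]; first by rewrite ones_geq ?min0n.
by rewrite ones_recr // IH; lia.
Qed.

Lemma ones_span (P : nat -> bool) a b t :
  (forall i k, a <= i <= k -> k < b -> P i -> P k -> k < i + t) -> ones P a b <= t.
Proof.
move=> H; case: (posnP (ones P a b)) => [-> //|/ones_gt0 [i0 i0ab Pi0]].
have ex : exists i, (a <= i) && P i by exists i0; rewrite Pi0; lia.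
case: (ex_minnP ex) => i /andP [ai Pi] imin.
have ii0 : i <= i0 by apply: imin; rewrite Pi0; lia.
rewrite (@ones_cat _ a i b) ?(@ones_none _ a i) => [|k ki|]; last by lia.
- case: (leqP b (i + t)) => bt; first by have := ones_leq P i b; lia.
  rewrite (@ones_cat _ i (i + t) b) ?(@ones_none _ (i + t) b); [|move=> k kb|lia].
    by have := ones_leq P i (i + t); lia.
  by apply/negP => Pk; have := H i k _ _ Pi Pk; lia.
- by apply/negP => Pk; have := imin k; rewrite Pk; lia.
Qed.

(** * Periodic words *)

Lemma valid_periodic p r s a d : 0 < p -> s + a <= d -> p + a <= d -> a <= r ->
  valid p r (fun i => s <= i %% d < s + a).
Proof.
move=> p0 sad pad ar; have d0 : 0 < d by lia.
have dE x := divn_eq x d; have dlt x := ltn_pmod x d0.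
split.
- move=> i j k ijk si sk sj.
  have Qij : i %/ d <= j %/ d by apply: leq_div2r; lia.
  have Qjk : j %/ d <= k %/ d by apply: leq_div2r; lia.
  have := dE i; have := dE j; have := dE k.
  have := dlt i; have := dlt j; have := dlt k.
  move: (i %/ d) (j %/ d) (k %/ d) (i %% d) (j %% d) (k %% d) si sj sk Qij Qjk.
  move=> qi qj qk ri rj rk si sj sk Qij Qjk ? ? ? Ek Ej Ei.
  (* Within one period the block is an interval, so [j] would be a one; across periods the gap has
     at least [d - a >= p] zeros. *)
  case: (eqVneq qi qk) => Q.
    have Q' : qj = qi by lia.
    by subst qk qj; lia.
  have : qi.+1 * d <= qk * d by rewrite leq_mul2r; lia.
  by rewrite mulSn; lia.
- move=> i j sij; case: (leqP j i) => ij; first lia.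
  have si : s <= i %% d < s + a by apply: sij; lia.
  rewrite leqNgt; apply/negP => jr.
  (* This is the position just behind the block of [i]. Its residue wraps to 0 when [s + a = d], and
     then [0 < p] forces [0 < s]. *)
  have := sij (i %/ d * d + (s + a)); rewrite modnMDl.
  have := dE i; set x := (s + a) %% d.
  have Hx : ~~ (s <= x < s + a).
    rewrite /x; case: (ltngtP (s + a) d) => [h|h|h];
      [rewrite modn_small //|lia|rewrite {1}h modnn]; lia.
  by rewrite (negbTE Hx); move: (_ * d) (i %% d) si => y z; lia.
Qed.

Lemma ones_modn c d q m : m < d -> c <= d ->
  ones (fun i => i %% d < c) 0 (q * d + m) = c * q + minn m c.
Proof.
move=> md cd.
have win k l : l <= d -> ones (fun i => i %% d < c) (k * d) (k * d + l) = minn l c.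
  move=> ld; rewrite -[X in ones _ X]addn0 ones_shift -ones_ltn.
  by apply: eq_ones => i il; rewrite modnMDl modn_small; lia.
rewrite (@ones_cat _ 0 (q * d)) ?win; [|lia|lia].
congr addn; elim: q => [|q IH]; first by rewrite ones_geq; lia.
by rewrite mulSnr (@ones_cat _ 0 (q * d)) ?win ?IH; lia.
Qed.

(** * The diameter for short runs and small words *)

Section Diameter.
Variables n p r : nat.
Notation word := (IGamma n p r).
Notation adj := (@IGamma_adj n p r).

Lemma eq_ones_letter (u : word) (f : nat -> bool) :
  (forall i, i < n -> letter u i = f i) -> ones (letter u) 0 n = ones f 0 n.
Proof. by move=> E; apply: eq_ones => i; apply: E. Qed.

Lemma diam_hamming (f g : nat -> bool) : valid p r f -> valid p r g ->
  ones f 0 n + ones g 0 n <= diam adj + 2 * ones (fun i => f i && g i) 0 n.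
Proof.
move=> /(word_of n) [u uf] /(word_of n) [v vg].
have := hamming_leq_dist u v; have := dist_leq_diam adj u v.
rewrite (eq_ones_letter uf) (eq_ones_letter vg).
rewrite (@eq_ones (fun i => letter u i && letter v i) (fun i => f i && g i)); first lia.
by move=> i i_n; rewrite uf ?vg.
Qed.

Lemma diam_geq_n : 0 < p <= r -> n <= diam adj.
Proof.
move=> pr; have p0 : 0 < 2 * p by lia.
(* Alternating blocks of length [p] give two complementary words. *)
have Vf : valid p r (fun i => 0 <= i %% (2 * p) < 0 + p) by apply: valid_periodic; lia.
have Vg : valid p r (fun i => p <= i %% (2 * p) < p + p) by apply: valid_periodic; lia.
have := diam_hamming Vf Vg; rewrite ones_addI.
rewrite ones_all => [|i _]; last by have := ltn_pmod i p0; lia.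
by rewrite ones_none => [|i _]; lia.
Qed.

(** The two sizes add up to the union, at most [n], plus the common ones; the matching pays for the
    latter up to [C * n / R]. *)
Lemma dist_matching r' R C (u v : word) :
  valid p r' (letter u) -> valid p r' (letter v) -> bounded_excess p r' R C ->
  R * dist adj u v <= R * n + C * n.
Proof.
move=> Vu Vv B; have [z [zuv cu cv] Hz] := kept_matching B n Vu Vv.
have zI i : z i -> letter u i && letter v i by case/zuv=> _ -> ->.
have /dist_leq D := dist_upper zI (or_intror (conj cu cv)).
rewrite ones_addI in D.
have := ones_leq (fun i => letter u i || letter v i) 0 n.
move: D Hz; set a := ones _ 0 n; set b := ones _ 0 n; set c := ones z 0 n.
move=> D Hz an; have D' : dist adj u v <= n + b - 2 * c by lia.
apply: (@leq_trans (R * (n + b - 2 * c))); first by rewrite leq_mul2l D' orbT.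
by rewrite mulnBr mulnDr; lia.
Qed.

(** No run exceeds [minn r n], and a positive excess needs a window of length [2 * p + 3]; so the
    excess bound holds with [C = 0]. *)
Lemma dist_leq_small (u v : word) : 0 < p -> minn r n <= 2 * p + 2 -> dist adj u v <= n.
Proof.
move=> p0 rn; have V (x : word) : valid p (minn r n) (letter x).
  have [G Rn] := letter_valid x; split; first exact: G.
  move=> i j xij; case: (leqP j i) => ij; first lia.
  have /xij /letter_lt jn : i <= j.-1 < j by lia.
  by have := Rn _ _ xij; lia.
suff B : bounded_excess p (minn r n) 1 0 by have := dist_matching (V u) (V v) B; lia.
move=> q t h h' hh' qh qg qr; rewrite !mul1n mul0n addn0 leqNgt; apply/negP => tq.
have qh' i : q i -> i < h' by move/qh; lia.
have := three_runs qg qr qh' tq.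
have /ones_gt0 [i _ /(runs_le_gt0 qr)] : 0 < ones q h h' by lia.
by lia.
Qed.

(** All common ones can be kept: for [r <= p + 1], two ones of one block are too close to have a gap
    of the other word between them. *)
Lemma dist_isometric (u v : word) : p <= 1 \/ r <= p + 1 ->
  dist adj u v <= ones (fun i => letter u i || letter v i) 0 n.
Proof.
move=> pr; pose z i := letter u i && letter v i.
have conv (x y : word) : r <= p + 1 -> convex_in (letter x) (fun i => letter x i && letter y i).
  move=> rp i k /andP [xi yi] /andP [xk yk] xik j ijk; rewrite xik //=.
  apply/negPn/negP => yj; have [G _] := letter_valid y; have [_ Rn] := letter_valid x.
  have ij : i != j by apply: contraNneq yj => <-.
  have kj : k != j by apply: contraNneq yj => <-.
  have : i + p < k by apply: (G i j k) => //; lia.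
  have : k.+1 <= i + r by apply: Rn => m ?; apply: xik; lia.
  by lia.
have cz : p <= 1 \/ convex_in (letter u) z /\ convex_in (letter v) z.
  case: pr => [|rp]; [by left | right; split; first exact: conv].
  move=> i k; rewrite /z ![letter u _ && _]andbC => zi zk vik j ijk.
  by rewrite andbC; apply: (conv v u rp i k zi zk vik j ijk).
have /dist_leq : reach adj _ u v := dist_upper (z := z) (fun i H => H) cz.
by rewrite ones_addI -/z; lia.
Qed.

(** A first run of length [s] and the [p] zeros behind it leave room for at most [r - s] further
    ones. *)
Lemma window_ones (u : word) a : ones (letter u) a (a + (p + r)) <= r.
Proof.
have [G Rn] := letter_valid u; rewrite leqNgt; apply/negP => ru.
pose h' := a + (p + r); pose q i := letter u i && (i < h').
have qu : ones q a h' = ones (letter u) a h'.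
  by apply: eq_ones => i /andP [_ ih]; rewrite /q ih andbT.
have qg : gapped p q.
  move=> i j k ijk /andP [ui _] /andP [uk kh]; rewrite negb_and => /orP [uj|]; last lia.
  exact: (G i j k).
have qr : runs_le r q by move=> i j qij; apply: Rn => k /qij /andP [].
have qh i : q i -> i < h' by case/andP.
have [|s [h1 [sr E hh]]] := @peel_run p r q a h' qg qr qh; first by rewrite qu.
by have := ones_leq q h1 h'; rewrite /h' in hh E ru qu *; lia.
Qed.

(** Each stretch of [p + r] positions holds at most [2 * r] ones of the union; two periodic words
    with adjacent blocks of length [r] attain this. *)
Lemma diam_short_runs : 0 < p -> r < p ->
  diam adj = 2 * r * (n %/ (p + r)) + minn (n %% (p + r)) (2 * r).
Proof.
move=> p0 rp; have d0 : 0 < p + r by lia.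
have md := ltn_pmod n d0; have nE := divn_eq n (p + r).
apply/eqP; rewrite eqn_leq; apply/andP; split.
- apply: diam_leq => u v; apply: leq_trans (dist_isometric u v _) _; first by right; lia.
  have win a m : m <= p + r ->
      ones (fun i => letter u i || letter v i) a (a + m) <= minn m (2 * r).
    move=> mpr; have := ones_leq (fun i => letter u i || letter v i) a (a + m).
    have := ones_addI (letter u) (letter v) a (a + m).
    have := window_ones u a; have := window_ones v a.
    by rewrite !(@ones_cat _ a (a + m) (a + (p + r))); lia.
  have G q : ones (fun i => letter u i || letter v i) 0 (q * (p + r)) <= 2 * r * q.
    elim: q => [|q IH]; first by rewrite ones_geq; lia.
    rewrite mulSnr (@ones_cat _ 0 (q * (p + r))); last lia.
    by have := win (q * (p + r)) (p + r) (leqnn _); lia.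
  rewrite [X in ones _ 0 X]nE (@ones_cat _ 0 (n %/ (p + r) * (p + r))) ?leq_addr //.
  by apply: leq_add; [apply: G | apply: win; lia].
- have Vf : valid p r (fun i => 0 <= i %% (p + r) < 0 + r) by apply: valid_periodic; lia.
  have Vg : valid p r (fun i => r <= i %% (p + r) < r + r) by apply: valid_periodic; lia.
  have := diam_hamming Vf Vg; rewrite ones_addI.
  rewrite (@ones_none (fun i => _ && _)) => [|i _]; last by lia.
  rewrite (@eq_ones _ (fun i => i %% (p + r) < 2 * r)) => [|i _]; last by lia.
  by rewrite {1}nE ones_modn; lia.
Qed.

End Diameter.

(** * Windows of maximal excess *)

Lemma bounded_max (P : nat -> Prop) B : (exists m, P m) -> (forall m, P m -> m <= B) ->
  exists2 m, P m & forall m', P m' -> m' <= m.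
Proof.
elim: B => [|B IH] exP PB.
  case: exP => m Pm; exists m => // m' /PB; lia.
case: (classic (P B.+1)) => PB1; first by exists B.+1.
apply: IH => // m Pm; have := PB _ Pm; rewrite leq_eqVlt => /orP [/eqP E|//].
by case: PB1; rewrite -E.
Qed.

(** As [t] only bounds the runs from above, [C] may fall short of the true excess. *)
Record excess_window p (w : nat -> bool) t R C : Prop := ExcessWindow {
  ew_gapped : gapped p w;
  ew_runs : runs_le t w;
  ew_lt : forall i, w i -> i < R;
  ew_ones : ones w 0 R = 2 * t + C }.

Lemma excess_window_bounds p w t R C : 0 < C -> excess_window p w t R C ->
  [/\ 0 < t, 2 * t + C + 2 * p <= R & 2 * p + 3 <= R].
Proof.
move=> C0 [wg wr wR w1].
have t0 : 0 < t.
  by have /ones_gt0 [i _ /(runs_le_gt0 wr)] : 0 < ones w 0 R by lia.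
by have := three_runs (h := 0) wg wr wR; rewrite w1 => H; split=> //; lia.
Qed.

(** Trimming a zero keeps the excess and shortens the window, which a window of best ratio cannot
    allow. *)
Lemma excess_window_drop_first p w t R C : 0 < R -> ~~ w 0 -> excess_window p w t R C ->
  excess_window p (fun i => w i.+1) t R.-1 C.
Proof.
move=> R0 w0 [wg wr wR w1]; split.
- by move=> i j k ijk wi wk wj; have := wg i.+1 j.+1 k.+1; move=> /(_ _ wi wk wj); lia.
- move=> i j wij; have : j.+1 <= i.+1 + t; last lia.
  apply: wr => k ik; have := wij k.-1; rewrite prednK; [apply; lia | lia].
- by move=> i /wR; lia.
- have -> : ones (fun i => w i.+1) 0 R.-1 = ones w 1 R.
    by rewrite -(ones_shift w 1) !add1n prednK.
  rewrite -w1 (@ones_cat w 0 1 R) ?(@ones_none w 0 1) // => i i0.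
  by have -> : i = 0 by lia.
Qed.

Lemma excess_window_drop_last p w t R C : 0 < R -> ~~ w R.-1 -> excess_window p w t R C ->
  excess_window p w t R.-1 C.
Proof.
move=> R0 w0 [wg wr wR w1]; split=> //.
- move=> i wi; have iR : i != R.-1 by apply: contraNneq w0 => <-.
  by have := wR i wi; lia.
- by rewrite -w1 -{2}(prednK R0) ones_recr // (negbTE w0) addn0.
Qed.

(** [R] and [C] maximise the ratio [C / R]; multiplying by [r`!] keeps the
    ratios in [nat]. *)
Lemma extremal_window p r : 0 < p -> 2 * p + 3 <= r ->
  exists w t R C, [/\ 0 < C, R <= r, excess_window p w t R C &
                      [/\ w 0, w R.-1 & bounded_excess p r R C]].
Proof.
move=> p0 pr.
pose P m := exists w t R C, [/\ 0 < C, R <= r, excess_window p w t R C &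
                                m = C * (r`! %/ R)].
have fact_div R : 0 < R <= r -> r`! %/ R * R = r`!.
  by move=> Rr; rewrite divnK // dvdn_fact.
have exP : exists m, P m.
  (* The word [1 0^p 1 0^p 1] has longest run 1, hence excess 1 in length [2 * p + 3]. *)
  exists (1 * (r`! %/ (2 * p + 3))).
  pose w i := [|| i == 0, i == p.+1 | i == 2 * p + 2].
  exists w, 1, (2 * p + 3), 1; split=> //; split.
  - by move=> i j k ijk; rewrite /w; lia.
  - move=> i j wij; rewrite leqNgt; apply/negP => ij.
    by have := wij i; have := wij i.+1; rewrite /w; lia.
  - by move=> i; rewrite /w; lia.
  - have w0 : w 0 by [].
    have w1 : w p.+1 && (p.+1 != 0) by rewrite /w eqxx orbT.
    have w2 : w (2 * p + 2) && (2 * p + 2 != 0) && (2 * p + 2 != p.+1).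
      by rewrite /w eqxx !orbT /=; apply/andP; split; lia.
    rewrite (ones_del (c := 0) _ w0); last by rewrite addnC.
    rewrite (ones_del (f := fun i => w i && (i != 0)) (c := p.+1) _ w1); last by clear; lia.
    rewrite (ones_del (f := fun i => w i && (i != 0) && (i != p.+1)) (c := 2 * p + 2) _ w2).
      rewrite ones_none // /w => i _ /=.
      by case: (i == 0); case: (i == p.+1); case: (i == 2 * p + 2).
    by clear; lia.
have [m [w [t [R [C [C0 Rr W Em]]]]] mmax] : exists2 m, P m & forall m', P m' -> m' <= m.
  apply: (@bounded_max P (r * r`!)) => // m [w [t [R [C [C0 Rr W ->]]]]].
  have [t0 HR HR'] := excess_window_bounds C0 W.
  by apply: leq_mul; [lia | apply: leq_div].
have [t0 HR HR'] := excess_window_bounds C0 W.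
(* Maximality with the factorial cancelled: no window has a ratio above [C / R]. *)
have cross w' t' R' C' : 0 < C' -> 0 < R' <= r -> excess_window p w' t' R' C' ->
    R * C' <= C * R'.
  move=> C0' Rr' W'; have H : C' * (r`! %/ R') <= m.
    by apply: mmax; exists w', t', R', C'; split=> //; case/andP: Rr'.
  rewrite Em in H.
  have f0 := fact_gt0 r.
  have F : r`! %/ R * R = r`! by apply: fact_div; lia.
  have F' := fact_div R' Rr'.
  move: F F' H; move: (r`! %/ R) (r`! %/ R') => y x F F' H.
  rewrite -(leq_pmul2l f0).
  have -> : r`! * (R * C') = C' * x * (R * R') by rewrite -F'; lia.
  have -> : r`! * (C * R') = C * y * (R * R') by rewrite -F; lia.
  by rewrite leq_mul.
have noshorter w' t' : ~ excess_window p w' t' R.-1 C.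
  move=> W'; have R1 : 0 < R.-1 <= r by lia.
  by have := cross w' t' R.-1 C C0 R1 W'; rewrite [C * _]mulnC leq_pmul2r //; lia.
exists w, t, R, C; split=> //; split.
- apply/negPn/negP => w0; apply: (noshorter (fun i => w i.+1) t).
  by apply: excess_window_drop_first => //; lia.
- apply/negPn/negP => w0; apply: (noshorter w t).
  by apply: excess_window_drop_last => //; lia.
(* A share [q] of positive excess, moved to the origin, is itself an excess window, so [cross]
   applies. *)
- move=> q t' h h' hh qh qg qr; case: (leqP (ones q h h') (2 * t')) => tq.
    by apply: (@leq_trans (R * (2 * t'))); rewrite ?leq_mul2l ?tq ?orbT ?leq_addr.
  have := ones_leq q h h' => oL.
  have W' : excess_window p (fun i => q (h + i)) t' (h' - h) (ones q h h' - 2 * t').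
    split.
    - move=> i j k ijk qi qk qj; have : h + i + p < h + k; last lia.
      by apply: (qg (h + i) (h + j)) => //; lia.
    - move=> i j qij; have : h + j <= h + i + t'; last lia.
      apply: qr => k hk; have -> : k = h + (k - h) by lia.
      by apply: qij; lia.
    - by move=> i /qh; lia.
    - by rewrite -ones_shift addn0 subnKC; lia.
  have /cross : 0 < ones q h h' - 2 * t' by lia.
  move=> /(_ _ _ _ _ W') H.
  have {}H : R * (ones q h h' - 2 * t') <= C * (h' - h) by apply: H; lia.
  by rewrite mulnBr in H; lia.
Qed.

(** With [d = R + p], the two words are the repetitions of [1^R 0^p] and, [k]
    times, of [w 1^p], followed by repetitions of [0^R 1^p]. *)
Section Tiling.
Variables (p r : nat) (w : nat -> bool) (t R C : nat).
Hypotheses (p1 : 1 < p) (C0 : 0 < C) (Rr : R <= r) (W : excess_window p w t R C).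
Hypotheses (w0 : w 0) (wR : w R.-1).
Variable k : nat.

Let d := R + p.
Definition tile_u i := 0 <= i %% d < 0 + R.
Definition tile_v i := w (i %% d) && (i %/ d < k) || (R <= i %% d).

Let bounds := excess_window_bounds C0 W.

Lemma tile_dec i : exists b l, i = b * d + l /\ l < d.
Proof.
by exists (i %/ d), (i %% d); rewrite -divn_eq ltn_pmod //; case: bounds; rewrite /d; lia.
Qed.

Lemma tile_uE b l : l < d -> tile_u (b * d + l) = (l < R).
Proof. by move=> ld; rewrite /tile_u modnMDl modn_small. Qed.

Lemma tile_vE b l : l < d -> tile_v (b * d + l) = w l && (b < k) || (R <= l).
Proof.
move=> ld; have d0 : 0 < d by apply: leq_ltn_trans ld.
by rewrite /tile_v modnMDl modn_small // divnMDl // divn_small // addn0.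
Qed.

Lemma tile_u_valid : valid p r tile_u.
Proof. by case: bounds => t0 H H'; apply: valid_periodic; rewrite /d; lia. Qed.

Lemma tile_v_run b x y : y <= R -> (forall l, x <= l < y -> tile_v (b * d + l)) -> y <= x + t.
Proof.
move=> yR H; apply: (ew_runs W) => l xy; have := H l xy; rewrite tile_vE; last by rewrite /d; lia.
by case/orP=> [/andP [] //|]; lia.
Qed.

(** Because [w] starts and ends with a one, its end runs merge with the neighbouring [1^p], and
    every gap inside a copy is a gap of [w]. *)
Lemma tile_v_valid : valid p r tile_v.
Proof.
have [t0 HR HR'] := bounds.
split.
- move=> i j l ijl vi vl; have [b [m [Ej md]]] := tile_dec j.
  rewrite Ej tile_vE // negb_or negb_and => /andP [wm mR].
  rewrite ltnNge; apply/negP => lip.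
  case: (ltnP b k) wm => bk; rewrite ?orbF ?orbT => wm.
    have m0 : m != 0 by apply: contraNneq wm => ->.
    have mR' : m != R.-1 by apply: contraNneq wm => ->.
    (* Both ones are clamped to the tile of [j]: truncated subtraction gives 0 and [minn] gives
       [R.-1], where [w] has ones. *)
    pose x := i - b * d; pose y := minn (l - b * d) R.-1.
    have wx : w x.
      rewrite /x; case: (leqP i (b * d)) => ib; first by have -> : i - b * d = 0 by lia.
      have xd : i - b * d < d by lia.
      move: vi; have {1}-> : i = b * d + (i - b * d) by lia.
      by rewrite tile_vE // bk andbT => /orP [//|]; lia.
    have wy : w y.
      rewrite /y; case: (leqP R.-1 (l - b * d)) => lb //.
      move: vl; have {1}-> : l = b * d + (l - b * d) by lia.
      by rewrite tile_vE ?bk ?andbT => [/orP [//|]|]; rewrite /d; lia.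
    have : x + p < y by apply: (ew_gapped W (i := x) (j := m)) => //; rewrite /x /y; lia.
    by rewrite /x /y; lia.
  (* Past the first [k] tiles the zero [j] lies among [R > p] consecutive zeros. *)
  have vz x : b * d <= x < b * d + R -> ~~ tile_v x.
    move=> bx; have -> : x = b * d + (x - b * d) by lia.
    by rewrite tile_vE ?ltnNge ?bk /d; lia.
  have ib : i < b * d.
    by rewrite ltnNge; apply/negP => bi; have := vz i; rewrite vi; lia.
  have lb : b * d + R <= l.
    by rewrite leqNgt; apply/negP => bi; have := vz l; rewrite vl; lia.
  lia.
- move=> x y vxy; apply: (@leq_trans (x + R)); last lia.
  have [b [l [Ex ld]]] := tile_dec x.
  (* A run covers at most [t] positions of the next tile, so its length is at most
     [2 * t + p <= R]. *)
  have next : y <= b.+1 * d + t.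
    rewrite leqNgt; apply/negP => yt.
    have : t.+1 <= 0 + t; last lia.
    apply: (@tile_v_run b.+1); first lia.
    by move=> m mt; apply: vxy; rewrite mulSn in yt *; lia.
  rewrite mulSn /d in next.
  case: (leqP R l) => Rl; first by rewrite Ex /d; lia.
  have first_part : minn (y - b * d) R <= l + t.
    apply: (@tile_v_run b); first lia.
    by move=> m lm; apply: vxy; lia.
  by rewrite Ex /d in first_part *; lia.
Qed.

Lemma tile_union i : tile_u i || tile_v i.
Proof. by rewrite /tile_u /tile_v; case: (leqP R (i %% d)) => // _; rewrite orbT. Qed.

Lemma tile_inter_ones b : b < k ->
  ones (fun i => tile_u i && tile_v i) (b * d) (b * d + d) = 2 * t + C.
Proof.
move=> bk; rewrite -[X in ones _ X]addn0 ones_shift -(ew_ones W).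
have E l : l < d -> tile_u (b * d + l) && tile_v (b * d + l) = w l && (l < R).
  by move=> ld; rewrite tile_uE // tile_vE // bk andbT ltnNge; case: (w l); case: (R <= l).
rewrite (@ones_cat _ 0 R d) ?(@ones_none _ R d); [|move=> i iR|]; last by rewrite /d; lia.
  by rewrite addn0; apply: eq_ones => i iR; rewrite E ?iR ?andbT // /d; lia.
by rewrite E; lia.
Qed.

(** The ones of [tile_u] in a tile form one block, so the kept ones there lie in one run of
    [tile_v], inside the copy of [w]. *)
Lemma tile_kept_window (P : nat -> bool) b : b < k ->
  (forall i, P i -> tile_u i && tile_v i) ->
  (forall i j, P i -> P j -> (forall m, i <= m <= j -> tile_u m) ->
     forall m, i <= m <= j -> tile_v m) ->
  ones P (b * d) (b * d + d) <= t.
Proof.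
have Rd : R <= d by apply: leq_addr.
move=> bk Puv PP; apply: ones_span => i j ij jd Pi Pj.
have jR : j < b * d + R.
  have /andP [uj _] := Puv _ Pj; move: uj; have -> : j = b * d + (j - b * d) by lia.
  by rewrite tile_uE; lia.
have uij m : i <= m <= j -> tile_u m.
  move=> mij; have -> : m = b * d + (m - b * d) by lia.
  by rewrite tile_uE; lia.
have : (j - b * d).+1 <= (i - b * d) + t; last lia.
apply: (@tile_v_run b); first lia.
by move=> l lij; apply: PP Pi Pj uij _ _; lia.
Qed.

End Tiling.

(** The union of the two words is everything. Each of the [k] full tiles has [2 * t + C] common
    ones, of which at most [t] persist, so it adds at least [C] to the distance. *)
Lemma diam_tiling n p r w t R C : 1 < p -> 0 < C -> R <= r -> excess_window p w t R C ->
  w 0 -> w R.-1 -> n + C * (n %/ (R + p)) <= diam (@IGamma_adj n p r).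
Proof.
move=> p1 C0 Rr W w0 wR; have [t0 HR HR'] := excess_window_bounds C0 W.
set k := n %/ (R + p); set d := R + p.
pose f := tile_u p R; pose g := tile_v p w R k.
have [u uf] := word_of (f := f) n (tile_u_valid p1 C0 Rr W w0 wR).
have [v vg] := word_of (f := g) n (tile_v_valid p1 C0 Rr W w0 wR k).
apply: leq_trans (dist_leq_diam _ u v).
have [P [Puv PP Pk]] := walk_lower p1 (dist_reach u v).
have Pn i : P i -> i < n by case/Puv/andP=> /letter_lt.
have Pfg i : P i -> f i && g i by move=> Pi; move: (Puv _ Pi); rewrite uf ?vg ?Pn.
have PPfg i j : P i -> P j -> (forall m, i <= m <= j -> f m) ->
    forall m, i <= m <= j -> g m.
  move=> Pi Pj fij m mij; have := Pn _ Pj => jn.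
  rewrite -vg; last lia.
  by apply: (PP i j) => // l lij; rewrite uf; [apply: fij | lia].
have kn : k * d <= n by apply: leq_trunc_div.
have G b : b <= k -> C * b + 2 * ones P 0 (b * d) <= ones (fun i => f i && g i) 0 (b * d).
  elim: b => [|b IH] bk; first by rewrite !ones_geq //; lia.
  rewrite [b.+1 * d]mulSnr !(@ones_cat _ 0 (b * d) (b * d + d)) ?leq_addr //.
  rewrite (tile_inter_ones p1 C0 Rr W w0 wR bk).
  have := tile_kept_window p1 C0 Rr W w0 wR bk Pfg PPfg.
  by have := IH (ltnW bk); rewrite -/d; lia.
have Gk := G _ (leqnn k).
have U : ones (fun i => f i || g i) 0 n = n by rewrite ones_all ?subn0 // => i _; apply: tile_union.
have tail : ones P 0 n <= ones P 0 (k * d) + ones P (k * d) n.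
  by rewrite (@ones_cat _ 0 (k * d) n).
(* Less than one tile remains, and there the ones of [tile_u] face [0^R]. *)
have Ptail : ones P (k * d) n = 0.
  apply: ones_none => i ki; apply/negP => Pi; have /andP [fi gi] := Pfg _ Pi.
  have E : i = k * d + (i - k * d) by lia.
  have md : i - k * d < d.
    have := ltn_ceil n (ltac:(lia) : 0 < d); rewrite -/k mulSn; lia.
  move: fi gi; rewrite E /f /g tile_uE ?tile_vE ?ltnn ?andbF //=; lia.
have mono : ones (fun i => f i && g i) 0 (k * d) <= ones (fun i => f i && g i) 0 n.
  by rewrite (@ones_cat _ 0 (k * d) n) ?leq_addr.
move: Pk; rewrite (eq_ones_letter uf) (eq_ones_letter vg) ones_addI U.
by move: mono Gk tail; rewrite Ptail; lia.
Qed.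

Lemma diam_long_runs n p r : 1 < p -> 2 * p + 3 <= r ->
  exists c r', 1 <= c /\ 2 * p + 3 <= r' <= r /\
    n + c * (n %/ (r' + p)) <= diam (@IGamma_adj n p r) <= n + c * ceil_divn n r'.
Proof.
move=> p1 pr; have [w [t [R [C [C0 Rr W [w0 wR B]]]]]] := extremal_window (ltnW p1) pr.
have [t0 HR HR'] := excess_window_bounds C0 W.
exists C, R; split=> //; split; first lia.
rewrite (diam_tiling n p1 C0 Rr W w0 wR) /=.
apply: diam_leq => u v.
have H := dist_matching (letter_valid u) (letter_valid v) B.
have R0 : 0 < R by lia.
(* Rounding [n] up to a multiple of [R] lets the factor [R] be cancelled. *)
have ceil : n <= R * ceil_divn n R.
  have := ltn_ceil (n + R.-1) R0; rewrite /ceil_divn mulSn.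
  by rewrite mulnC; lia.
rewrite -(leq_pmul2l R0); apply: leq_trans H _.
rewrite mulnDr leq_add2l mulnCA leq_mul2l ceil orbT //.
Qed.

Theorem theorem4p5 (p r n : nat) (hp : 1 <= p) (hr : 1 <= r) (hn : 1 <= n) :
  (p = 1 -> diam (@IGamma_adj n p r) = n) /\
  (2 <= p ->
     (r < p ->
        diam (@IGamma_adj n p r) =
          2 * r * (n %/ (p + r)) + minn (n %% (p + r)) (2 * r)) /\
     (p <= r <= p + 1 -> diam (@IGamma_adj n p r) = n) /\
     (p + 2 <= r <= 2 * p + 2 -> diam (@IGamma_adj n p r) = n) /\
     (2 * p + 3 <= r -> n < 2 * p + 3 -> diam (@IGamma_adj n p r) = n) /\
     (2 * p + 3 <= r -> 2 * p + 3 <= n ->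
        exists c r' : nat,
          1 <= c /\ 2 * p + 3 <= r' <= r /\
          n + c * (n %/ (r' + p)) <= diam (@IGamma_adj n p r)
            <= n + c * ceil_divn n r')).
Proof.
have isometric : p <= 1 \/ r <= p + 1 -> p <= r -> diam (@IGamma_adj n p r) = n.
  move=> iso pr; apply/eqP; rewrite eqn_leq diam_geq_n ?hp // andbT.
  apply: diam_leq => u v; apply: leq_trans (dist_isometric u v iso) _.
  by rewrite -[leqRHS]subn0 ones_leq.
(* One bound serves both [r <= 2 * p + 2] and [n < 2 * p + 3]. *)
have short : minn r n <= 2 * p + 2 -> p <= r -> diam (@IGamma_adj n p r) = n.
  move=> rn pr; apply/eqP; rewrite eqn_leq diam_geq_n ?hp // andbT.
  by apply: diam_leq => u v; apply: dist_leq_small.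
split; first by move=> p1; apply: isometric; [left | ]; lia.
move=> p2; do ![split].
- exact: diam_short_runs.
- by move=> pr; apply: isometric; [right | ]; lia.
- by move=> pr; apply: short; lia.
- by move=> pr np; apply: short; lia.
- by move=> pr _; apply: diam_long_runs.
Qed.
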